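(* Let $(X,\mathcal{U})$ be a quasi-uniform space, $T\colon X\to 2^X$ a multivalued map and $x^*\in X$ with $Tx^*\neq\emptyset$. The following are equivalent: (i) $U(x^* )\cap U^{-1}(z)\neq\emptyset$ for every $U\in\mathcal{U}$ and every $z\in Tx^*$; (ii) $(x^*,z)\in\bigcap\mathcal{U}$ for every $z\in Tx^*$. In particular, condition (i) implies that every $z\in Tx^*$ witnesses $x^*$ as a $\mathcal{U}$-startpoint of $T$.
   Context: $X$ is a non-empty set. A quasi-uniformity on $X$ is a filter $\mathcal{U}$ on $X\times X$ such that every $U\in\mathcal{U}$ contains the diagonal $\Delta_X$ and for every $U\in\mathcal{U}$ there is $V\in\mathcal{U}$ with $V\circ V\subseteq U$, where $V\circ V=\{(x,z):\exists y,\ (x,y)\in V,\ (y,z)\in V\}$. For $U\in\mathcal{U}$ and $x\in X$: $U(x)=\{y\in X:(x,y)\in U\}$ and $U^{-1}(x)=\{y\in X:(y,x)\in U\}$. $\bigcap\mathcal{U}:=\bigcap_{U\in\mathcal{U}}U$. A point $x_0$ is a $\mathcal{U}$-startpoint of $T\colon X\to 2^X$ if there exists $z\in Tx_0$ with $(x_0,z)\in\bigcap\mathcal{U}$; such a $z$ is said to witness $x_0$ as a $\mathcal{U}$-startpoint. *)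

(* Defs.v *)
From mathcomp Require Import all_boot.
From mathcomp Require Import boolp classical_sets filter.

Set Implicit Arguments.
Unset Strict Implicit.
Unset Printing Implicit Defensive.

Local Open Scope classical_set_scope.

Record quasi_uniformity (X : Type) (UU : set_system (X * X)) : Prop := {
  quasi_uniformity_filter : ProperFilter UU;
  quasi_uniformity_refl : forall U, UU U -> diagonal `<=` U;
  quasi_uniformity_split : forall U, UU U ->
    exists2 V, UU V & (V \; V)%relation `<=` U
}.

Definition witnesses_startpoint (X : Type) (UU : set_system (X * X))
    (T : X -> set X) (x0 z : X) : Prop :=
  T x0 z /\ (\bigcap_(U in UU) U) (x0, z).

Definition startpoint (X : Type) (UU : set_system (X * X))
    (T : X -> set X) (x0 : X) : Prop :=
  exists z, witnesses_startpoint UU T x0 z.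

(* Main.v *)
Require Import Defs.
From mathcomp Require Import all_boot.
From mathcomp Require Import boolp classical_sets filter.

Local Open Scope classical_set_scope.

(** A common point of [xsection U xs] and [ysection U z] is exactly a midpoint placing [(xs, z)] in
    [U \; U]. Condition (i) thus says that [(xs, z)] lies in the square of every entourage, and by
    [bigcap_entourages_comp] the squares have the same intersection as the entourages. *)

Lemma xsection_meets_ysectionP (X : Type) (U : set (X * X)) (x z : X) :
  xsection U x `&` ysection U z !=set0 <-> (U \; U)%relation (x, z).
Proof.
split=> [[y [/xsectionP Uxy /ysectionP Uyz]]|[y Uxy Uyz]]; first by exists y.
by exists y; split; [apply/xsectionP|apply/ysectionP].
Qed.

(** Each entourage contains the square of another by the splitting axiom, and is contained in its
    own square by reflexivity. *)
Lemma bigcap_entourages_comp (X : Type) (UU : set_system (X * X)) (x z : X) :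
  quasi_uniformity UU ->
  (forall U, UU U -> (U \; U)%relation (x, z)) <-> (\bigcap_(U in UU) U) (x, z).
Proof.
move=> [_ UUrefl UUsplit]; split=> [UUxz U /UUsplit[V UUV]|UUxz U UUU].
  by apply; exact: UUxz.
(* The midpoint is [x] itself, since [(x, x)] is on the diagonal. *)
by exists x; [exact: UUrefl UUU _ _|exact: UUxz].
Qed.

Theorem proposition3p2 (X : Type) (UU : set_system (X * X))
    (T : X -> set X) (xs : X) :
  [set: X] !=set0 ->
  quasi_uniformity UU ->
  T xs !=set0 ->
  ((forall U z, UU U -> T xs z -> xsection U xs `&` ysection U z !=set0) <->
   (forall z, T xs z -> (\bigcap_(U in UU) U) (xs, z))) /\
  ((forall U z, UU U -> T xs z -> xsection U xs `&` ysection U z !=set0) ->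
   forall z, T xs z -> witnesses_startpoint UU T xs z).
Proof.
move=> _ UUqu _.
(* Isolated because it gives both one direction of the equivalence and the startpoint claim. *)
have meets_bigcap :
    (forall U z, UU U -> T xs z -> xsection U xs `&` ysection U z !=set0) ->
    forall z, T xs z -> (\bigcap_(U in UU) U) (xs, z).
  move=> meets z Tz; apply/(bigcap_entourages_comp _ _ _ _ UUqu) => U UUU.
  by apply/xsection_meets_ysectionP; exact: meets.
split; last by move=> meets z Tz; split=> //; exact: meets_bigcap.
split=> // inter U z UUU Tz; apply/xsection_meets_ysectionP.
by have /(bigcap_entourages_comp _ _ _ _ UUqu) := inter _ Tz; apply.
Qed.
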